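(* Let $\mu\in(0,1)$ and let $\nu\ge0$ be an integer; write $\alpha=\frac{1+\mu}{2\mu}$, $\delta=\frac{1-\mu}{2\mu}$. Let $P_n$, $Q_n$ be the functions defined in the context, $n=0,1,\ldots$. (a) The functions $P_n(x)$ satisfy the five term recurrence relation $$xP_n(x)=a_{2,n}P_{n+2}(x)+a_{1,n}P_{n+1}(x)+a_{0,n}P_n(x)+a_{-1,n}P_{n-1}(x)+a_{-2,n}P_{n-2}(x),$$ where $$a_{2,n}=\frac{1}{(n+2)(n+1)}\frac{\delta^2}{(\alpha^2-\delta^2)^2},\qquad a_{1,n}=\frac{1}{\alpha^2-\delta^2}+\frac{2(2n+\nu+2)}{n+1}\frac{\delta^2}{(\alpha^2-\delta^2)^2},$$ $$a_{0,n}=\frac{3n^2+2\nu n+3n+\nu+1}{\alpha^2-\delta^2}+(6n^2+6n\nu+\nu^2+6n+3\nu+2)\frac{\delta^2}{(\alpha^2-\delta^2)^2},$$ $$a_{-1,n}=\frac{n^2(n+\nu)(3n+\nu)}{\alpha^2-\delta^2}+2n^2(\nu+n)(2n+\nu)\frac{\delta^2}{(\alpha^2-\delta^2)^2},$$ $$a_{-2,n}=(\nu+n)(\nu+n-1)n^2(n-1)^2\frac{\alpha^2}{(\alpha^2-\delta^2)^2}.$$ (b) The functions $Q_n(y)$ satisfy the five term recurrence relation $$yQ_n(y)=b_{2,n}Q_{n+2}(y)+b_{1,n}Q_{n+1}(y)+b_{0,n}Q_n(y)+b_{-1,n}Q_{n-1}(y)+b_{-2,n}Q_{n-2}(y),$$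 where $$b_{2,n}=(\nu+n+2)(\nu+n+1)(n+2)^2(n+1)^2\frac{\alpha^2}{(\alpha^2-\delta^2)^2},$$ $$b_{1,n}=-\frac{(n+1)^2(n+\nu+1)^2}{\alpha^2-\delta^2}+2(2n+\nu+2)(n+\nu+1)(n+1)^2\frac{\alpha^2}{(\alpha^2-\delta^2)^2},$$ $$b_{0,n}=-\frac{(n+\nu)^2+2(n+1)(n+\nu)+n+1}{\alpha^2-\delta^2}+\big((n+\nu)(5n+\nu+3)+n(n+3)+2\big)\frac{\alpha^2}{(\alpha^2-\delta^2)^2},$$ $$b_{-1,n}=-\frac{3n+2\nu}{n}\frac{1}{\alpha^2-\delta^2}+\frac{2(2n+\nu)}{n}\frac{\alpha^2}{(\alpha^2-\delta^2)^2},\qquad b_{-2,n}=\frac{1}{n(n-1)}\frac{\delta^2}{(\alpha^2-\delta^2)^2}.$$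
   Context: $I_\kappa$ and $K_\kappa$ are the modified Bessel functions of the first and second kind; $(a)_k=a(a+1)\cdots(a+k-1)$ is the Pochhammer symbol. For $n=0,1,\ldots$ and $x,y>0$, $$P_n(x)=(-1)^n(\nu+n)!\,n!\sum_{k=0}^n\frac{(\alpha^2-\delta^2)^{k+\frac12}}{\delta^k}\frac{(-n)_k}{(\nu+k)!\,k!}\,x^{\frac k2}I_k(2\delta\sqrt x),$$ $$Q_n(y)=(-1)^n\frac{2}{(n!)^2}\sum_{l=0}^n\frac{(\alpha^2-\delta^2)^{l+\nu+\frac12}}{\alpha^{l+\nu}}\frac{(-n)_l}{(\nu+l)!\,l!}\,y^{\frac{l+\nu}2}K_{l+\nu}(2\alpha\sqrt y).$$ Convention: $P_{-1}=P_{-2}=Q_{-1}=Q_{-2}=0$, and terms containing these functions are omitted (so the undefined coefficients $b_{-1,0}$, $b_{-2,0}$, $b_{-2,1}$ play no role). *)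

(* Defs.v *)
From Stdlib Require Export Reals ZArith.
From Coquelicot Require Export Coquelicot.

Open Scope R_scope.

(* Modified Bessel function of the first kind, of integer order k >= 0:
   I_k(z) = sum_(m >= 0) (z/2)^(2m+k) / (m! (m+k)!)  (DLMF 10.25.2). *)
Definition BesselI (k : nat) (z : R) : R :=
  Series (fun m => (z / 2) ^ (2 * m + k) / (INR (fact m) * INR (fact (m + k)))).

(* Modified Bessel function of the second kind, of real order a, for z > 0:
   K_a(z) = int_0^oo exp (- z cosh t) cosh (a t) dt  (DLMF 10.32.9). *)
Definition BesselK (a z : R) : R :=
  RInt_gen (fun t => exp (- (z * cosh t)) * cosh (a * t))
           (at_point 0) (Rbar_locally p_infty).

Fixpoint pochhammer (a : R) (k : nat) : R :=
  match k with
  | O => 1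
  | S j => pochhammer a j * (a + INR j)
  end.

Definition P_nat (alpha delta : R) (nu n : nat) (x : R) : R :=
  (-1) ^ n * INR (fact (nu + n)) * INR (fact n) *
  sum_f_R0 (fun k =>
    Rpower (alpha ^ 2 - delta ^ 2) (INR k + 1 / 2) / delta ^ k *
    (pochhammer (- INR n) k / (INR (fact (nu + k)) * INR (fact k))) *
    Rpower x (INR k / 2) * BesselI k (2 * delta * sqrt x)) n.

Definition Q_nat (alpha delta : R) (nu n : nat) (y : R) : R :=
  (-1) ^ n * (2 / INR (fact n) ^ 2) *
  sum_f_R0 (fun l =>
    Rpower (alpha ^ 2 - delta ^ 2) (INR l + INR nu + 1 / 2) / alpha ^ (l + nu) *
    (pochhammer (- INR n) l / (INR (fact (nu + l)) * INR (fact l))) *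
    Rpower y (INR (l + nu) / 2) * BesselK (INR (l + nu)) (2 * alpha * sqrt y)) n.

(* Functions with negative index vanish; in particular every term in which
   such a function occurs is zero, whatever its coefficient. *)
Definition P (alpha delta : R) (nu : nat) (n : Z) (x : R) : R :=
  if (n <? 0)%Z then 0 else P_nat alpha delta nu (Z.to_nat n) x.

Definition Q (alpha delta : R) (nu : nat) (n : Z) (y : R) : R :=
  if (n <? 0)%Z then 0 else Q_nat alpha delta nu (Z.to_nat n) y.

(* Recurrence coefficients: [a_m2] stands for a_{-2,n}, [a_m1] for a_{-1,n},
   and similarly for b. *)
Definition a_2 (alpha delta nu n : R) : R :=
  1 / ((n + 2) * (n + 1)) * (delta ^ 2 / (alpha ^ 2 - delta ^ 2) ^ 2).

Definition a_1 (alpha delta nu n : R) : R :=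
  1 / (alpha ^ 2 - delta ^ 2) +
  2 * (2 * n + nu + 2) / (n + 1) * (delta ^ 2 / (alpha ^ 2 - delta ^ 2) ^ 2).

Definition a_0 (alpha delta nu n : R) : R :=
  (3 * n ^ 2 + 2 * nu * n + 3 * n + nu + 1) / (alpha ^ 2 - delta ^ 2) +
  (6 * n ^ 2 + 6 * n * nu + nu ^ 2 + 6 * n + 3 * nu + 2) *
    (delta ^ 2 / (alpha ^ 2 - delta ^ 2) ^ 2).

Definition a_m1 (alpha delta nu n : R) : R :=
  n ^ 2 * (n + nu) * (3 * n + nu) / (alpha ^ 2 - delta ^ 2) +
  2 * n ^ 2 * (nu + n) * (2 * n + nu) *
    (delta ^ 2 / (alpha ^ 2 - delta ^ 2) ^ 2).

Definition a_m2 (alpha delta nu n : R) : R :=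
  (nu + n) * (nu + n - 1) * n ^ 2 * (n - 1) ^ 2 *
    (alpha ^ 2 / (alpha ^ 2 - delta ^ 2) ^ 2).

Definition b_2 (alpha delta nu n : R) : R :=
  (nu + n + 2) * (nu + n + 1) * (n + 2) ^ 2 * (n + 1) ^ 2 *
    (alpha ^ 2 / (alpha ^ 2 - delta ^ 2) ^ 2).

Definition b_1 (alpha delta nu n : R) : R :=
  - ((n + 1) ^ 2 * (n + nu + 1) ^ 2 / (alpha ^ 2 - delta ^ 2)) +
  2 * (2 * n + nu + 2) * (n + nu + 1) * (n + 1) ^ 2 *
    (alpha ^ 2 / (alpha ^ 2 - delta ^ 2) ^ 2).

Definition b_0 (alpha delta nu n : R) : R :=
  - (((n + nu) ^ 2 + 2 * (n + 1) * (n + nu) + n + 1) / (alpha ^ 2 - delta ^ 2)) +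
  ((n + nu) * (5 * n + nu + 3) + n * (n + 3) + 2) *
    (alpha ^ 2 / (alpha ^ 2 - delta ^ 2) ^ 2).

(* At n = 0, and for [b_m2] also at n = 1, the division by zero below has an
   irrelevant value: the coefficient then multiplies a vanishing Q. *)
Definition b_m1 (alpha delta nu n : R) : R :=
  - ((3 * n + 2 * nu) / n * (1 / (alpha ^ 2 - delta ^ 2))) +
  2 * (2 * n + nu) / n * (alpha ^ 2 / (alpha ^ 2 - delta ^ 2) ^ 2).

Definition b_m2 (alpha delta nu n : R) : R :=
  1 / (n * (n - 1)) * (delta ^ 2 / (alpha ^ 2 - delta ^ 2) ^ 2).

(* Main.v *)
Require Import Defs.
From Stdlib Require Import Reals ZArith Lra Lia.
From Coquelicot Require Import Coquelicot.

(* With [s = alpha^2 - delta^2], both families are, up to a factor depending on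
   [n], of the form [sum_k r^k (-n)_k / ((nu+k)! k!) g_k], where
   [g_k = x^(k/2) I_k (2 delta sqrt x)], [r = s / delta] for P, and
   [g_k = y^((k+nu)/2) K_(k+nu) (2 alpha sqrt y)], [r = s / alpha] for Q.
   The three-term recurrences of the Bessel functions give
   [x g_k = g_(k+2) + e_k g_(k+1)], so that both sides of the claim become
   combinations of the [g_k] whose coefficients agree one by one.  That
   comparison is an identity of rational functions in which [n] may be any real
   number; for n = 0, 1 the terms of negative index carry a vanishing factor. *)

Open Scope R_scope.

(** * Multiplication by [x] on finite combinations of the [g_k], and the coefficient identities *)

(** Expand each [x * g k] and collect: [g (k+2)] receives [c k] from the first term and
    [e (k+1) * c (k+1)] from the second. At the top index [N + 2] the latter would come from the
    absent term [c (N+1)], which explains the correction on the right. *)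
Lemma sum_three_term (x : R) (g e c d : nat -> R) (N : nat) :
  (forall k, x * g k = g (S (S k)) + e k * g (S k)) ->
  d 0%nat = 0 -> d 1%nat = e 0%nat * c 0%nat ->
  (forall k, d (S (S k)) = c k + e (S k) * c (S k)) ->
  sum_f_R0 (fun k => d k * g k) (S (S N)) =
  x * sum_f_R0 (fun k => c k * g k) N + e (S N) * c (S N) * g (S (S N)).
Proof.
  intros Hg H0 H1 H2; induction N as [|N IH].
  - simpl; rewrite H0, H1, H2.
    replace (x * (c 0%nat * g 0%nat)) with (c 0%nat * (x * g 0%nat)) by ring.
    rewrite Hg; ring.
  - rewrite tech5, IH, H2, (tech5 _ N).
    replace (x * (sum_f_R0 (fun k => c k * g k) N + c (S N) * g (S N)))
      with (x * sum_f_R0 (fun k => c k * g k) N + c (S N) * (x * g (S N))) by ring.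
    rewrite Hg; ring.
Qed.

(** The definition splits off the last factor; splitting off the first allows symbols whose
    parameters differ by an integer to be compared. *)
Lemma pochhammer_S_l (a : R) (k : nat) :
  pochhammer a (S k) = a * pochhammer (a + 1) k.
Proof.
  induction k as [|k IH]; [simpl; ring|].
  change (pochhammer a (S k) * (a + INR (S k)) =
          a * (pochhammer (a + 1) k * (a + 1 + INR k))).
  rewrite IH, S_INR; ring.
Qed.

Lemma pochhammer_opp_INR_eq0 (n k : nat) : (n < k)%nat -> pochhammer (- INR n) k = 0.
Proof.
  induction 1 as [|k _ IH]; simpl; [ring|rewrite IH; ring].
Qed.

Lemma INR_fact_S (n : nat) : INR (fact (S n)) = (INR n + 1) * INR (fact n).
Proof. rewrite fact_simpl, mult_INR, S_INR; ring. Qed.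

(** The parameter [t] is real, so that [t - 1] and [t - 2] remain meaningful when [t] is 0 or 1. *)
Definition ucoef (r : R) (nu : nat) (t : R) (k : nat) : R :=
  r ^ k * pochhammer (- t) k / (INR (fact (nu + k)) * INR (fact k)).

Ltac ucoef_field nu :=
  pose proof (INR_fact_neq_0 nu); pose proof (pos_INR nu);
  unfold ucoef; rewrite ?Nat.add_succ_r, ?Nat.add_0_r, ?INR_fact_S;
  cbn [pochhammer pow fact]; rewrite ?S_INR; cbn [INR];
  field; repeat split; try assumption; try lra.

(* The right-hand side of the recurrence, with [a_j] multiplied by
   [normP (n + j) / normP n] (defined below), [q = 1 / s] and [t] for [n];
   likewise [five_term_Q] with [b_j] and [normQ]. *)
Definition five_term_P (r q : R) (nu : nat) (t : R) (k : nat) : R :=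
    (INR nu + t + 2) * (INR nu + t + 1) / r ^ 2 * ucoef r nu (t + 2) k
  - (INR nu + t + 1) * ((t + 1) * q + 2 * (2 * t + INR nu + 2) / r ^ 2) * ucoef r nu (t + 1) k
  + ((3 * t ^ 2 + 2 * INR nu * t + 3 * t + INR nu + 1) * q
     + (6 * t ^ 2 + 6 * t * INR nu + INR nu ^ 2 + 6 * t + 3 * INR nu + 2) / r ^ 2) * ucoef r nu t k
  - (t * (3 * t + INR nu) * q + 2 * t * (2 * t + INR nu) / r ^ 2) * ucoef r nu (t - 1) k
  + t * (t - 1) * (q + 1 / r ^ 2) * ucoef r nu (t - 2) k.

Definition five_term_Q (r q : R) (nu : nat) (t : R) (k : nat) : R :=
    (INR nu + t + 2) * (INR nu + t + 1) / r ^ 2 * ucoef r nu (t + 2) k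
  + ((t + INR nu + 1) ^ 2 * q - 2 * (2 * t + INR nu + 2) * (t + INR nu + 1) / r ^ 2) * ucoef r nu (t + 1) k
  + (- ((t + INR nu) ^ 2 + 2 * (t + 1) * (t + INR nu) + t + 1) * q
     + ((t + INR nu) * (5 * t + INR nu + 3) + t * (t + 3) + 2) / r ^ 2) * ucoef r nu t k
  + (t * (3 * t + 2 * INR nu) * q - 2 * t * (2 * t + INR nu) / r ^ 2) * ucoef r nu (t - 1) k
  + t * (t - 1) * (1 / r ^ 2 - q) * ucoef r nu (t - 2) k.

(* Brings every Pochhammer symbol to a multiple of [pochhammer (- t + 2) k]. *)
Ltac pochhammer_shifts t :=
  replace (- (t + 2)) with (- t - 2) by ring;
  replace (- (t + 1)) with (- t - 1) by ring;
  replace (- (t - 1)) with (- t + 1) by ring;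
  replace (- (t - 2)) with (- t + 2) by ring;
  rewrite ?(pochhammer_S_l (- t - 2));
  replace (- t - 2 + 1) with (- t - 1) by ring;
  rewrite ?(pochhammer_S_l (- t - 1));
  replace (- t - 1 + 1) with (- t) by ring;
  rewrite ?(pochhammer_S_l (- t));
  rewrite ?(pochhammer_S_l (- t + 1));
  replace (- t + 1 + 1) with (- t + 2) by ring.

Ltac ucoef_shift_field r nu t j Hr :=
  unfold ucoef; pochhammer_shifts t;
  rewrite ?Nat.add_succ_r, ?INR_fact_S, ?S_INR, ?plus_INR;
  cbn [pochhammer pow]; rewrite ?S_INR, ?plus_INR, ?S_INR;
  pose proof (INR_fact_neq_0 (nu + j)); pose proof (INR_fact_neq_0 j);
  pose proof (pos_INR nu); pose proof (pos_INR j); pose proof (pow_nonzero r j Hr);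
  field; repeat split; try assumption; try lra.

(** This lemma and the five after it supply the hypotheses on [d] in [sum_three_term], with
    [c = ucoef r nu t] and [e k = (k+1) q r] for P, [e k = - (k+nu+1) q r] for Q. *)
Lemma five_term_P_0 (r q : R) (nu : nat) (t : R) :
  r <> 0 -> five_term_P r q nu t 0 = 0.
Proof. intros Hr; unfold five_term_P; ucoef_field nu. Qed.

Lemma five_term_Q_0 (r q : R) (nu : nat) (t : R) :
  r <> 0 -> five_term_Q r q nu t 0 = 0.
Proof. intros Hr; unfold five_term_Q; ucoef_field nu. Qed.

Lemma five_term_P_1 (r q : R) (nu : nat) (t : R) :
  r <> 0 -> five_term_P r q nu t 1 = q * r * ucoef r nu t 0.
Proof. intros Hr; unfold five_term_P; ucoef_field nu. Qed.

Lemma five_term_Q_1 (r q : R) (nu : nat) (t : R) :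
  r <> 0 -> five_term_Q r q nu t 1 = - ((INR nu + 1) * q * r) * ucoef r nu t 0.
Proof. intros Hr; unfold five_term_Q; ucoef_field nu. Qed.

Lemma five_term_P_SS (r q : R) (nu : nat) (t : R) (k : nat) : r <> 0 ->
  five_term_P r q nu t (S (S k)) =
  ucoef r nu t k + (INR k + 2) * q * r * ucoef r nu t (S k).
Proof.
  (* The shortest symbol is [(-t)_k], in [ucoef r nu t k]; it contains the two factors to be split
     off before [-t + 2] only from [k = 2] on. The cases 0 and 1 are expanded completely. *)
  intros Hr; unfold five_term_P; destruct k as [|[|k]]; [ucoef_field nu|ucoef_field nu|].
  ucoef_shift_field r nu t k Hr.
Qed.

Lemma five_term_Q_SS (r q : R) (nu : nat) (t : R) (k : nat) : r <> 0 ->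
  five_term_Q r q nu t (S (S k)) =
  ucoef r nu t k - (INR k + INR nu + 2) * q * r * ucoef r nu t (S k).
Proof.
  intros Hr; unfold five_term_Q; destruct k as [|[|k]]; [ucoef_field nu|ucoef_field nu|].
  ucoef_shift_field r nu t k Hr.
Qed.

(** * The recurrence of the functions [I_k], from their power series *)

(** Since [(m+k)! >= 1], the terms are dominated by [|w|^k (w^2)^m / m!], a multiple of the
    exponential series at [w^2]. *)
Lemma ex_series_BesselI (k : nat) (w : R) :
  ex_series (fun m => w ^ (2 * m + k) / (INR (fact m) * INR (fact (m + k)))).
Proof.
  apply (@ex_series_le _ R_CompleteNormedModule) with
    (b := fun m => Rabs w ^ k * ((w ^ 2) ^ m * / INR (fact m))).
  - intros m; change norm with Rabs.
    pose proof (INR_fact_lt_0 m) as Hm; pose proof (INR_fact_lt_0 (m + k)) as Hmk.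
    assert (1 <= INR (fact (m + k))) by (apply (le_INR 1), lt_O_fact).
    unfold Rdiv; rewrite Rabs_mult, Rinv_mult, (Rabs_pos_eq (/ _ * _))
      by (apply Rlt_le, Rmult_lt_0_compat; apply Rinv_0_lt_compat; assumption).
    rewrite <- RPow_abs, pow_add, pow_mult, pow2_abs.
    replace (Rabs w ^ k * ((w ^ 2) ^ m * / INR (fact m)))
      with ((w ^ 2) ^ m * Rabs w ^ k * (/ INR (fact m) * 1)) by ring.
    apply Rmult_le_compat_l.
    + apply Rmult_le_pos; apply pow_le; [apply pow2_ge_0|apply Rabs_pos].
    + apply Rmult_le_compat_l; [now apply Rlt_le, Rinv_0_lt_compat|].
      rewrite <- Rinv_1; apply Rinv_le_contravar; lra.
  - apply (@ex_series_scal R_AbsRing R_NormedModule (Rabs w ^ k) (fun m => (w ^ 2) ^ m * / INR (fact m))).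
    exists (exp (w ^ 2)).
    apply (is_series_ext (fun m => scal (pow_n (w ^ 2) m) (/ INR (fact m)))).
    + intros m; rewrite pow_n_pow; reflexivity.
    + exact (is_exp_Reals (w ^ 2)).
Qed.

(** With [T] as below, [T k (m+1) = T (k+2) m + (k+1)/w * T (k+1) (m+1)], because
    [(m+k+2) - (k+1) = m+1] cancels one factor of [(m+1)!]. *)
Lemma BesselI_recurrence (k : nat) (z : R) : z <> 0 ->
  BesselI k z = BesselI (S (S k)) z + 2 * (INR k + 1) / z * BesselI (S k) z.
Proof.
  intros Hz; unfold BesselI; set (w := z / 2).
  assert (Hw : w <> 0) by (unfold w; lra).
  replace (2 * (INR k + 1) / z) with ((INR k + 1) / w) by (unfold w; field; lra).
  set (T := fun k m => w ^ (2 * m + k) / (INR (fact m) * INR (fact (m + k)))).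
  assert (HT : forall j, ex_series (T j)) by (intros; apply ex_series_BesselI).
  change (Series (T k) = Series (T (S (S k))) + (INR k + 1) / w * Series (T (S k))).
  assert (Hsc : ex_series (fun m => (INR k + 1) / w * T (S k) m))
    by apply (@ex_series_scal R_AbsRing R_NormedModule ((INR k + 1) / w) (T (S k))), HT.
  rewrite <- Series_scal_l, (Series_incr_1 (T k)), (Series_incr_1 (fun m => (INR k + 1) / w * T (S k) m))
    by auto.
  (* The series of order [k+2] enters shifted by one index, so the initial terms of the other two
     have to match by themselves. *)
  assert (H0 : T k 0%nat = (INR k + 1) / w * T (S k) 0%nat).
  { unfold T; rewrite !Nat.mul_0_r, !Nat.add_0_l, INR_fact_S; cbn [fact pow INR].
    pose proof (INR_fact_neq_0 k); pose proof (pos_INR k); field; lra. }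
  rewrite H0, (Rplus_comm (Series (T (S (S k))))), Rplus_assoc; f_equal.
  rewrite <- Series_plus by (auto; apply (ex_series_incr_1 (fun m => (INR k + 1) / w * T (S k) m)), Hsc).
  apply Series_ext; intros m; unfold T.
  replace (2 * S m + k)%nat with (S (S (2 * m + k))) by lia.
  replace (2 * m + S (S k))%nat with (S (S (2 * m + k))) by lia.
  replace (2 * S m + S k)%nat with (S (S (S (2 * m + k)))) by lia.
  replace (S m + S k)%nat with (S (S (m + k))) by lia.
  replace (m + S (S k))%nat with (S (S (m + k))) by lia.
  change (S m + k)%nat with (S (m + k)).
  rewrite !INR_fact_S, S_INR, plus_INR; cbn [pow].
  pose proof (INR_fact_neq_0 m); pose proof (INR_fact_neq_0 (m + k)).
  pose proof (pos_INR m); pose proof (pos_INR k); field; repeat split; try assumption; lra.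
Qed.

(** * Improper integrals and the recurrence of the functions [K_a] *)

Lemma is_RInt_gen_p_infty (f F : R -> R) (a l : R) :
  (forall b, a <= b -> is_RInt f a b (F b)) -> is_lim F p_infty l ->
  is_RInt_gen f (at_point a) (Rbar_locally p_infty) l.
Proof.
  intros Hf HF U HU.
  destruct (HF U HU) as [M HM].
  exists (fun x => x = a) (fun b => Rmax a M < b).
  - reflexivity.
  - now exists (Rmax a M).
  - intros x b -> Hb; exists (F b); simpl; split.
    + apply Hf; apply Rlt_le; eapply Rle_lt_trans; [apply Rmax_l|exact Hb].
    + apply HM; eapply Rle_lt_trans; [apply Rmax_r|exact Hb].
Qed.

(** The integrals over [[a, b]] increase with [b] and are bounded, hence converge to their
    supremum. *)
Lemma ex_RInt_gen_p_infty_nonneg (f : R -> R) (a M : R) :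
  (forall t, continuous f t) -> (forall t, a <= t -> 0 <= f t) ->
  (forall b, a <= b -> RInt f a b <= M) ->
  exists l, is_RInt_gen f (at_point a) (Rbar_locally p_infty) l.
Proof.
  intros Hc Hpos HM.
  assert (Hex : forall b c, ex_RInt f b c) by (intros; apply (@ex_RInt_continuous R_CompleteNormedModule); auto).
  assert (Hmono : forall b c, a <= b -> b <= c -> RInt f a b <= RInt f a c).
  { intros b c Hab Hbc; rewrite <- (RInt_Chasles f a b c) by auto.
    assert (0 <= RInt f b c) by (apply RInt_ge_0; auto; intros; apply Hpos; lra).
    change plus with Rplus; lra. }
  destruct (completeness (fun v => exists b, a <= b /\ v = RInt f a b)) as [l [Hub Hlub]].
  - exists M; intros v (b & Hb & ->); auto.
  - exists (RInt f a a), a; split; [lra|reflexivity].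
  - exists l; apply is_RInt_gen_p_infty with (F := RInt f a).
    + intros b _; apply (@RInt_correct R_CompleteNormedModule); auto.
    + apply is_lim_spec; intros eps; simpl.
      assert (Hb : exists b, a <= b /\ l - eps < RInt f a b).
      { apply Classical_Prop.NNPP; intros Hn.
        assert (l <= l - eps); [|destruct eps; simpl in *; lra].
        apply Hlub; intros v (b & Hb & ->); apply Rnot_lt_le; intros Hlt; apply Hn; eauto. }
      destruct Hb as (b & Hab & Hb); exists b; intros c Hbc.
      assert (RInt f a c <= l) by (apply Hub; exists c; split; [lra|reflexivity]).
      assert (RInt f a b <= RInt f a c) by (apply Hmono; lra).
      destruct eps as [e He]; simpl in *; rewrite Rabs_left1; lra.
Qed.

(** For [t >= 0], [exp t = exp (t/2)^2 >= (1 + t/2)^2 >= t^2/4], and [cosh t] is at least half of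
    [exp t]. *)
Lemma cosh_ge_quadratic (t : R) : 0 <= t -> t ^ 2 / 8 <= cosh t.
Proof.
  intros Ht; unfold cosh.
  pose proof (exp_pos (- t)); pose proof (exp_ineq1_le (t / 2)).
  replace (exp t) with (exp (t / 2) * exp (t / 2)) by (rewrite <- exp_plus; f_equal; lra).
  nra.
Qed.

(** By the quadratic bound on [cosh], the exponent is at most [- z t^2/8 + (a+1) t - t]; completing
    the square bounds the first two terms by [2 (a+1)^2 / z]. This controls both the Bessel
    integrand and the boundary term of the integration by parts. *)
Lemma exp_opp_cosh_decay (a z t : R) : 0 < z -> 0 <= t ->
  exp (- (z * cosh t)) * exp (a * t) <= exp (2 * (a + 1) ^ 2 / z) * exp (- t).
Proof.
  intros Hz Ht; rewrite <- !exp_plus.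
  assert (H : - (z * cosh t) + a * t <= 2 * (a + 1) ^ 2 / z + - t).
  { pose proof (Rmult_le_compat_l z _ _ (Rlt_le _ _ Hz) (cosh_ge_quadratic t Ht)).
    assert (Hsq : 0 <= z / 8 * (t - 4 * (a + 1) / z) ^ 2)
      by (apply Rmult_le_pos; [lra|apply pow2_ge_0]).
    replace (z / 8 * (t - 4 * (a + 1) / z) ^ 2)
      with (z * (t ^ 2 / 8) - (a + 1) * t + 2 * (a + 1) ^ 2 / z) in Hsq by (field; lra).
    lra. }
  destruct H as [H| ->]; [left; now apply exp_increasing|apply Rle_refl].
Qed.

Lemma cosh_sinh_le_exp (x : R) : 0 <= x -> 0 <= sinh x <= exp x /\ 0 <= cosh x <= exp x.
Proof.
  intros Hx; unfold sinh, cosh.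
  pose proof (exp_pos x); pose proof (exp_pos (- x)).
  assert (exp (- x) <= exp x).
  { destruct Hx as [Hx| <-]; [left; apply exp_increasing; lra|rewrite Ropp_0; apply Rle_refl]. }
  lra.
Qed.

Lemma is_lim_scal_exp_opp (C : R) : is_lim (fun t => C * exp (- t)) p_infty 0.
Proof.
  replace (Finite 0) with (Rbar_mult C 0) by (simpl; f_equal; ring).
  apply is_lim_scal_l.
  apply (is_lim_comp exp Ropp p_infty 0 m_infty).
  - apply is_lim_exp_m.
  - apply (is_lim_opp (fun y => y) p_infty p_infty), is_lim_id.
  - exists 0; intros; discriminate.
Qed.

Definition bessel_kernel (a z t : R) : R := exp (- (z * cosh t)) * cosh (a * t).

Lemma continuous_bessel_kernel (a z t : R) : continuous (bessel_kernel a z) t.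
Proof.
  apply (@ex_derive_continuous R_AbsRing); unfold bessel_kernel, cosh; auto_derive; auto.
Qed.

(** [BesselK] is defined by the total operator [RInt_gen], so convergence has to be shown before its
    value can be used. The kernel is nonnegative and at most [C exp (-t)], whose integral over
    [[0, b]] is [C (1 - exp (-b)) <= C]. *)
Lemma is_RInt_gen_BesselK (a z : R) : 0 <= a -> 0 < z ->
  is_RInt_gen (bessel_kernel a z) (at_point 0) (Rbar_locally p_infty) (BesselK a z).
Proof.
  intros Ha Hz; set (C := exp (2 * (a + 1) ^ 2 / z)).
  assert (HC : 0 < C) by apply exp_pos.
  destruct (ex_RInt_gen_p_infty_nonneg (bessel_kernel a z) 0 C) as [l Hl].
  - apply continuous_bessel_kernel.
  - intros t Ht; apply Rmult_le_pos; [apply Rlt_le, exp_pos|].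
    apply cosh_sinh_le_exp; nra.
  - intros b Hb.
    assert (HI : is_RInt (fun t => C * exp (- t)) 0 b (minus (- (C * exp (- b))) (- (C * exp (- 0))))).
    { apply (@is_RInt_derive R_CompleteNormedModule (fun t => - (C * exp (- t)))).
      - intros; auto_derive; [auto|ring].
      - intros; apply (@ex_derive_continuous R_AbsRing); auto_derive; auto. }
    apply Rle_trans with (RInt (fun t => C * exp (- t)) 0 b).
    + apply RInt_le; [assumption| |eexists; apply HI|].
      * apply (@ex_RInt_continuous R_CompleteNormedModule); intros; apply continuous_bessel_kernel.
      * intros t Ht; eapply Rle_trans; [|apply exp_opp_cosh_decay; lra].
        apply Rmult_le_compat_l; [apply Rlt_le, exp_pos|apply cosh_sinh_le_exp; nra].
    + rewrite (is_RInt_unique _ _ _ _ HI).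
      change (- (C * exp (- b)) + - - (C * exp (- 0)) <= C).
      rewrite Ropp_0, exp_0.
      pose proof (Rmult_lt_0_compat _ _ HC (exp_pos (- b))); lra.
  - unfold BesselK; change (fun t => _) with (bessel_kernel a z).
    erewrite is_RInt_gen_unique; eassumption.
Qed.

(* Integration by parts: the integrand is the derivative of
   [exp (- z cosh t) sinh (a t)], which vanishes at [0] and at infinity. *)
Lemma is_RInt_gen_BesselK_by_parts (a z : R) : 0 <= a -> 0 < z ->
  is_RInt_gen (fun t => exp (- (z * cosh t)) * (a * cosh (a * t) - z * sinh t * sinh (a * t)))
    (at_point 0) (Rbar_locally p_infty) 0.
Proof.
  intros Ha Hz; apply is_RInt_gen_p_infty with (F := fun t => exp (- (z * cosh t)) * sinh (a * t)).
  - intros b _.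
    replace (exp (- (z * cosh b)) * sinh (a * b))
      with (minus (exp (- (z * cosh b)) * sinh (a * b)) (exp (- (z * cosh 0)) * sinh (a * 0))).
    2:{ change (exp (- (z * cosh b)) * sinh (a * b) - exp (- (z * cosh 0)) * sinh (a * 0) =
          exp (- (z * cosh b)) * sinh (a * b)); rewrite Rmult_0_r, sinh_0; ring. }
    apply (@is_RInt_derive R_CompleteNormedModule (fun t => exp (- (z * cosh t)) * sinh (a * t))).
    + intros t _; unfold cosh, sinh; auto_derive; [auto|unfold Rdiv; field].
    + intros t _; apply (@ex_derive_continuous R_AbsRing); unfold cosh, sinh; auto_derive; auto.
  (* Squeeze: [0 <= sinh (a t) <= exp (a t)] for [t >= 0] reduces the boundary term to the decay
     bound. *)
  - apply (is_lim_le_le_loc (fun _ => 0) (fun t => exp (2 * (a + 1) ^ 2 / z) * exp (- t))).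
    + exists 0; intros t Ht.
      destruct (cosh_sinh_le_exp (a * t)) as [[Hs0 Hs] _]; [nra|].
      pose proof (exp_pos (- (z * cosh t))); split; [nra|].
      eapply Rle_trans; [|apply exp_opp_cosh_decay; lra].
      apply Rmult_le_compat_l; lra.
    + apply is_lim_const.
    + apply is_lim_scal_exp_opp.
Qed.

(** The integrands of orders [a+2] and [a] differ by [exp (- z cosh t)] times
    [2 sinh t sinh ((a+1) t)]. Adding [-2/z] times the vanishing integral by parts, at order [a+1],
    turns this product into [2 (a+1)/z * cosh ((a+1) t)]. *)
Lemma BesselK_recurrence (a z : R) : 0 <= a -> 0 < z ->
  BesselK (a + 2) z = BesselK a z + 2 * (a + 1) / z * BesselK (a + 1) z.
Proof.
  intros Ha Hz; unfold BesselK at 1; apply is_RInt_gen_unique.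
  pose proof (is_RInt_gen_BesselK a z Ha Hz) as H0.
  pose proof (@is_RInt_gen_scal R_NormedModule (at_point 0) (Rbar_locally p_infty) _ _
    _ (2 * (a + 1) / z) _ (is_RInt_gen_BesselK (a + 1) z ltac:(lra) Hz)) as H1.
  pose proof (@is_RInt_gen_scal R_NormedModule (at_point 0) (Rbar_locally p_infty) _ _
    _ (- 2 / z) _ (is_RInt_gen_BesselK_by_parts (a + 1) z ltac:(lra) Hz)) as H2.
  pose proof (@is_RInt_gen_plus R_NormedModule _ _ _ _ _ _ _ _
    (@is_RInt_gen_plus R_NormedModule _ _ _ _ _ _ _ _ H0 H1) H2) as H.
  replace (BesselK a z + 2 * (a + 1) / z * BesselK (a + 1) z)
    with (BesselK a z + 2 * (a + 1) / z * BesselK (a + 1) z + - 2 / z * 0) by ring.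
  revert H; apply is_RInt_gen_ext, filter_forall.
  intros _ t _.
  match goal with |- _ = ?r =>
    change (bessel_kernel a z t + 2 * (a + 1) / z * bessel_kernel (a + 1) z t
      + - 2 / z * (exp (- (z * cosh t)) *
          ((a + 1) * cosh ((a + 1) * t) - z * sinh t * sinh ((a + 1) * t))) = r :> R)
  end.
  unfold bessel_kernel.
  (* Written as [(a+1) t + t] and [(a+1) t - t], all arguments reduce to exponentials of [(a+1) t]
     and [t] and their opposites. *)
  replace ((a + 2) * t) with ((a + 1) * t + t) by ring.
  replace (a * t) with ((a + 1) * t + - t) by ring.
  set (E := exp (- (z * cosh t))); unfold cosh, sinh.
  rewrite !Ropp_plus_distr, !Ropp_involutive, !exp_plus.
  field; lra.
Qed.

(** * Five-term recurrences for the unnormalised sums *)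

Definition usum (r : R) (nu : nat) (g : nat -> R) (t : R) (N : nat) : R :=
  sum_f_R0 (fun k => ucoef r nu t k * g k) N.

Lemma ucoef_eq0 (r : R) (nu n k : nat) : (n < k)%nat -> ucoef r nu (INR n) k = 0.
Proof.
  intros H; unfold ucoef; rewrite pochhammer_opp_INR_eq0 by exact H; unfold Rdiv; ring.
Qed.

(** The terms with [k > n] contain [(-n)_k = 0]. Hence the sums for [n - 2, ..., n + 2] can share
    the upper limit [n + 2] and be compared term by term. *)
Lemma usum_truncate (r : R) (nu : nat) (g : nat -> R) (n m : nat) :
  usum r nu g (INR n) (m + n) = usum r nu g (INR n) n.
Proof.
  induction m as [|m IH]; [reflexivity|].
  rewrite <- IH; unfold usum; simpl.
  rewrite ucoef_eq0 by lia; ring.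
Qed.

(** This is [sum_three_term] with [five_term_P] as coefficients, followed by linearity. For [n < 2],
    a sum [U] at a negative argument is still defined, but its factor [t] or [t (t-1)] is zero. *)
Lemma usum_recurrence_P (r q : R) (nu n : nat) (x : R) (g : nat -> R) : r <> 0 ->
  (forall k, x * g k = g (S (S k)) + (INR k + 1) * q * r * g (S k)) ->
  let t := INR n in let U t := usum r nu g t (S (S n)) in
  x * usum r nu g t n =
    (INR nu + t + 2) * (INR nu + t + 1) / r ^ 2 * U (t + 2)
  - (INR nu + t + 1) * ((t + 1) * q + 2 * (2 * t + INR nu + 2) / r ^ 2) * U (t + 1)
  + ((3 * t ^ 2 + 2 * INR nu * t + 3 * t + INR nu + 1) * q
     + (6 * t ^ 2 + 6 * t * INR nu + INR nu ^ 2 + 6 * t + 3 * INR nu + 2) / r ^ 2) * U t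
  - (t * (3 * t + INR nu) * q + 2 * t * (2 * t + INR nu) / r ^ 2) * U (t - 1)
  + t * (t - 1) * (q + 1 / r ^ 2) * U (t - 2).
Proof.
  intros Hr Hg t U.
  pose proof (sum_three_term x g (fun k => (INR k + 1) * q * r) (ucoef r nu t)
    (five_term_P r q nu t) n Hg) as H; cbv beta in H.
  (* This removes the correction term of [sum_three_term]. *)
  assert (E : ucoef r nu t (S n) = 0) by (apply ucoef_eq0; lia).
  rewrite E, Rmult_0_r, Rmult_0_l, Rplus_0_r in H.
  unfold usum at 1; rewrite <- H; clear H.
  - unfold U, usum; induction (S (S n)) as [|N IH]; [cbn [sum_f_R0]; unfold five_term_P; ring|].
    rewrite !tech5, IH; unfold five_term_P; ring.
  - now apply five_term_P_0.
  - rewrite five_term_P_1 by exact Hr; simpl; ring.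
  - intros k; rewrite five_term_P_SS, S_INR by exact Hr; ring.
Qed.

Lemma usum_recurrence_Q (r q : R) (nu n : nat) (x : R) (g : nat -> R) : r <> 0 ->
  (forall k, x * g k = g (S (S k)) + - ((INR k + INR nu + 1) * q * r) * g (S k)) ->
  let t := INR n in let U t := usum r nu g t (S (S n)) in
  x * usum r nu g t n =
    (INR nu + t + 2) * (INR nu + t + 1) / r ^ 2 * U (t + 2)
  + ((t + INR nu + 1) ^ 2 * q
     - 2 * (2 * t + INR nu + 2) * (t + INR nu + 1) / r ^ 2) * U (t + 1)
  + (- ((t + INR nu) ^ 2 + 2 * (t + 1) * (t + INR nu) + t + 1) * q
     + ((t + INR nu) * (5 * t + INR nu + 3) + t * (t + 3) + 2) / r ^ 2) * U t
  + (t * (3 * t + 2 * INR nu) * q - 2 * t * (2 * t + INR nu) / r ^ 2) * U (t - 1)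
  + t * (t - 1) * (1 / r ^ 2 - q) * U (t - 2).
Proof.
  intros Hr Hg t U.
  pose proof (sum_three_term x g (fun k => - ((INR k + INR nu + 1) * q * r)) (ucoef r nu t)
    (five_term_Q r q nu t) n Hg) as H; cbv beta in H.
  assert (E : ucoef r nu t (S n) = 0) by (apply ucoef_eq0; lia).
  rewrite E, Rmult_0_r, Rmult_0_l, Rplus_0_r in H.
  unfold usum at 1; rewrite <- H; clear H.
  - unfold U, usum; induction (S (S n)) as [|N IH]; [cbn [sum_f_R0]; unfold five_term_Q; ring|].
    rewrite !tech5, IH; unfold five_term_Q; ring.
  - now apply five_term_Q_0.
  - rewrite five_term_Q_1 by exact Hr; simpl; ring.
  - intros k; rewrite five_term_Q_SS, S_INR by exact Hr; ring.
Qed.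

(** * The Bessel bases and the normalising factors *)

Definition basisP (delta x : R) (k : nat) : R :=
  sqrt x ^ k * BesselI k (2 * delta * sqrt x).

Definition basisQ (alpha : R) (nu : nat) (y : R) (k : nat) : R :=
  sqrt y ^ (k + nu) * BesselK (INR (k + nu)) (2 * alpha * sqrt y).

Lemma basisP_recurrence (delta x : R) (k : nat) : delta <> 0 -> 0 < x ->
  x * basisP delta x k =
  basisP delta x (S (S k)) + (INR k + 1) / delta * basisP delta x (S k).
Proof.
  intros Hd Hx; unfold basisP; pose proof (sqrt_lt_R0 x Hx).
  rewrite <- (sqrt_sqrt x) at 1 by lra.
  rewrite (BesselI_recurrence k) by (apply Rmult_integral_contrapositive; split; lra).
  simpl; field; lra.
Qed.

Lemma basisQ_recurrence (alpha y : R) (nu k : nat) : 0 < alpha -> 0 < y ->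
  y * basisQ alpha nu y k =
  basisQ alpha nu y (S (S k)) - (INR k + INR nu + 1) / alpha * basisQ alpha nu y (S k).
Proof.
  intros Ha Hy; unfold basisQ; pose proof (sqrt_lt_R0 y Hy).
  rewrite <- (sqrt_sqrt y) at 1 by lra.
  assert (E1 : INR (S k + nu) = INR (k + nu) + 1) by (rewrite <- S_INR; reflexivity).
  assert (E2 : INR (S (S k) + nu) = INR (k + nu) + 2)
    by (simpl Nat.add; rewrite !S_INR; ring).
  rewrite E1, E2, BesselK_recurrence; [|apply pos_INR|nra].
  rewrite plus_INR; simpl; field; lra.
Qed.

Lemma Rpower_half_INR (x : R) (k : nat) : 0 < x -> Rpower x (INR k / 2) = sqrt x ^ k.
Proof.
  intros Hx; replace (INR k / 2) with (/ 2 * INR k) by field.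
  rewrite <- Rpower_mult, Rpower_sqrt by exact Hx.
  apply Rpower_pow, sqrt_lt_R0, Hx.
Qed.

(** The part of the summands independent of [k], once [(s/delta)^k] (for Q, [(s/alpha)^k]) has gone
    into [ucoef]: the square root comes from the exponent 1/2, and the power [nu] in [normQ] from
    the shift by [nu]. *)
Definition normP (alpha delta : R) (nu n : nat) : R :=
  (-1) ^ n * INR (fact (nu + n)) * INR (fact n) * sqrt (alpha ^ 2 - delta ^ 2).

Definition normQ (alpha delta : R) (nu n : nat) : R :=
  (-1) ^ n * (2 / INR (fact n) ^ 2) *
  (((alpha ^ 2 - delta ^ 2) / alpha) ^ nu * sqrt (alpha ^ 2 - delta ^ 2)).

(** The free [m] serves to bring the indices [n + 2, ..., n - 2] to the common upper limit [n + 2],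
    with [m = 0, ..., 4]. *)
Lemma P_of_nat (alpha delta : R) (nu n m : nat) (x : R) :
  delta <> 0 -> 0 < alpha ^ 2 - delta ^ 2 -> 0 < x ->
  P alpha delta nu (Z.of_nat n) x =
  normP alpha delta nu n *
  usum ((alpha ^ 2 - delta ^ 2) / delta) nu (basisP delta x) (INR n) (m + n).
Proof.
  intros Hd Hs Hx; rewrite usum_truncate; unfold P.
  replace (Z.of_nat n <? 0)%Z with false by (symmetry; apply Z.ltb_ge; lia).
  rewrite Nat2Z.id; unfold P_nat, normP.
  rewrite (Rmult_assoc (_ * INR (fact n))); f_equal.
  unfold usum; rewrite scal_sum; apply sum_eq; intros k _.
  unfold ucoef, basisP.
  rewrite Rpower_half_INR, Rpower_plus, Rpower_pow by assumption.
  replace (1 / 2) with (/ 2) by field; rewrite Rpower_sqrt by exact Hs.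
  unfold Rdiv; rewrite Rpow_mult_distr, pow_inv; ring.
Qed.

Lemma Q_of_nat (alpha delta : R) (nu n m : nat) (y : R) :
  alpha <> 0 -> 0 < alpha ^ 2 - delta ^ 2 -> 0 < y ->
  Q alpha delta nu (Z.of_nat n) y =
  normQ alpha delta nu n *
  usum ((alpha ^ 2 - delta ^ 2) / alpha) nu (basisQ alpha nu y) (INR n) (m + n).
Proof.
  intros Ha Hs Hy; rewrite usum_truncate; unfold Q.
  replace (Z.of_nat n <? 0)%Z with false by (symmetry; apply Z.ltb_ge; lia).
  rewrite Nat2Z.id; unfold Q_nat, normQ.
  rewrite (Rmult_assoc ((-1) ^ n * _)); f_equal.
  unfold usum; rewrite scal_sum; apply sum_eq; intros k _.
  unfold ucoef, basisQ.
  rewrite Rpower_half_INR, !Rpower_plus, !Rpower_pow by assumption.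
  replace (1 / 2) with (/ 2) by field; rewrite Rpower_sqrt by exact Hs.
  rewrite pow_add; unfold Rdiv; rewrite !Rpow_mult_distr, !pow_inv, Rinv_mult; ring.
Qed.

Lemma P_neg (alpha delta : R) (nu : nat) (n : Z) (x : R) : (n < 0)%Z -> P alpha delta nu n x = 0.
Proof. intros Hn; unfold P; now rewrite (proj2 (Z.ltb_lt n 0) Hn). Qed.

Lemma Q_neg (alpha delta : R) (nu : nat) (n : Z) (y : R) : (n < 0)%Z -> Q alpha delta nu n y = 0.
Proof. intros Hn; unfold Q; now rewrite (proj2 (Z.ltb_lt n 0) Hn). Qed.

Lemma normP_S (alpha delta : R) (nu n : nat) :
  normP alpha delta nu (S n) =
  - ((INR nu + INR n + 1) * (INR n + 1)) * normP alpha delta nu n.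
Proof.
  unfold normP; rewrite Nat.add_succ_r, !INR_fact_S, plus_INR; simpl; ring.
Qed.

Lemma normQ_S (alpha delta : R) (nu n : nat) :
  normQ alpha delta nu n = - (INR n + 1) ^ 2 * normQ alpha delta nu (S n).
Proof.
  unfold normQ; rewrite INR_fact_S; cbn [pow].
  set (c := _ ^ nu * sqrt _).
  pose proof (INR_fact_neq_0 n); pose proof (pos_INR n); field; split; [assumption|lra].
Qed.

(** * The recurrences with their normalised coefficients *)

Lemma P_recurrence (alpha delta : R) (nu n : nat) (x : R) :
  delta <> 0 -> 0 < alpha ^ 2 - delta ^ 2 -> 0 < x ->
  x * P alpha delta nu (Z.of_nat n) x =
    a_2 alpha delta (INR nu) (INR n) * P alpha delta nu (Z.of_nat n + 2) x
  + a_1 alpha delta (INR nu) (INR n) * P alpha delta nu (Z.of_nat n + 1) x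
  + a_0 alpha delta (INR nu) (INR n) * P alpha delta nu (Z.of_nat n) x
  + a_m1 alpha delta (INR nu) (INR n) * P alpha delta nu (Z.of_nat n - 1) x
  + a_m2 alpha delta (INR nu) (INR n) * P alpha delta nu (Z.of_nat n - 2) x.
Proof.
  intros Hd Hs Hx.
  set (s := alpha ^ 2 - delta ^ 2) in *.
  assert (Hr : s / delta <> 0)
    by (apply Rmult_integral_contrapositive; split; [lra|now apply Rinv_neq_0_compat]).
  set (U := fun t => usum (s / delta) nu (basisP delta x) t (S (S n))).
  set (c := normP alpha delta nu n).
  pose proof (pos_INR n) as Hn.
  assert (H2 : P alpha delta nu (Z.of_nat n + 2) x =
    (INR nu + INR n + 2) * (INR n + 2) * (INR nu + INR n + 1) * (INR n + 1) * c * U (INR n + 2)).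
  { replace (Z.of_nat n + 2)%Z with (Z.of_nat (S (S n))) by lia.
    rewrite (P_of_nat _ _ _ _ 0), !normP_S, !S_INR by assumption.
    unfold U; replace (INR n + 2) with (INR n + 1 + 1) by ring; fold c s; simpl Nat.add; ring. }
  assert (H1 : P alpha delta nu (Z.of_nat n + 1) x =
    - ((INR nu + INR n + 1) * (INR n + 1)) * c * U (INR n + 1)).
  { replace (Z.of_nat n + 1)%Z with (Z.of_nat (S n)) by lia.
    rewrite (P_of_nat _ _ _ _ 1), normP_S, S_INR by assumption; reflexivity. }
  assert (H0 : P alpha delta nu (Z.of_nat n) x = c * U (INR n))
    by (now apply (P_of_nat _ _ _ _ 2)).
  (* The weight is a factor of [a_m1]: it absorbs the ratio of the normalisations without division,
     and it makes both sides vanish at [n = 0]. The weight in [Hm2] does the same for [a_m2] at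
     [n = 0] and [n = 1]. *)
  assert (Hm1 : INR n ^ 2 * (INR n + INR nu) * P alpha delta nu (Z.of_nat n - 1) x =
    - INR n * c * U (INR n - 1)).
  { destruct n as [|n]; [rewrite P_neg by lia; simpl; ring|].
    replace (Z.of_nat (S n) - 1)%Z with (Z.of_nat n) by lia.
    unfold U, c; rewrite normP_S, S_INR, (P_of_nat _ _ _ _ 3) by assumption.
    replace (INR n + 1 - 1) with (INR n) by ring; fold s; simpl Nat.add; ring. }
  assert (Hm2 : (INR nu + INR n) * (INR nu + INR n - 1) * INR n ^ 2 * (INR n - 1) ^ 2 *
      P alpha delta nu (Z.of_nat n - 2) x = INR n * (INR n - 1) * c * U (INR n - 2)).
  { destruct n as [|[|n]]; [rewrite P_neg by lia; simpl; ring|rewrite P_neg by lia; simpl; ring|].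
    replace (Z.of_nat (S (S n)) - 2)%Z with (Z.of_nat n) by lia.
    unfold U, c; rewrite !normP_S, !S_INR, (P_of_nat _ _ _ _ 4) by assumption.
    replace (INR n + 1 + 1 - 2) with (INR n) by ring; fold s; simpl Nat.add; ring. }
  (* With [r = s/delta] and [q = 1/s], [q r = 1/delta] is the coefficient in [basisP_recurrence] and
     [1/r^2] is the [delta^2/s^2] of the [a_j]. *)
  assert (Key := usum_recurrence_P (s / delta) (/ s) nu n x (basisP delta x) Hr).
  cbv zeta in Key.
  rewrite <- (usum_truncate _ _ _ _ 2) in Key; change (2 + n)%nat with (S (S n)) in Key.
  fold (U (INR n + 2)) (U (INR n + 1)) (U (INR n)) (U (INR n - 1)) (U (INR n - 2)) in Key.
  replace (a_m1 alpha delta (INR nu) (INR n) * P alpha delta nu (Z.of_nat n - 1) x) with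
    (((3 * INR n + INR nu) / s + 2 * (2 * INR n + INR nu) * (delta ^ 2 / s ^ 2)) *
     (INR n ^ 2 * (INR n + INR nu) * P alpha delta nu (Z.of_nat n - 1) x))
    by (unfold a_m1; fold s; field; lra).
  (* Here [alpha^2 = s + delta^2] turns [alpha^2/s^2] into [q + 1/r^2]. *)
  replace (a_m2 alpha delta (INR nu) (INR n) * P alpha delta nu (Z.of_nat n - 2) x) with
    ((s + delta ^ 2) / s ^ 2 *
     ((INR nu + INR n) * (INR nu + INR n - 1) * INR n ^ 2 * (INR n - 1) ^ 2 *
      P alpha delta nu (Z.of_nat n - 2) x))
    by (unfold a_m2; fold s; replace (alpha ^ 2) with (s + delta ^ 2) by (unfold s; ring);
        field; lra).
  rewrite Hm2, Hm1, H2, H1, H0.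
  replace (x * (c * U (INR n))) with (c * (x * U (INR n))) by ring.
  rewrite Key.
  - unfold a_2, a_1, a_0; fold s; field; lra.
  - intros k; rewrite basisP_recurrence by assumption; field; lra.
Qed.

Lemma Q_recurrence (alpha delta : R) (nu n : nat) (y : R) :
  0 < alpha -> 0 < alpha ^ 2 - delta ^ 2 -> 0 < y ->
  y * Q alpha delta nu (Z.of_nat n) y =
    b_2 alpha delta (INR nu) (INR n) * Q alpha delta nu (Z.of_nat n + 2) y
  + b_1 alpha delta (INR nu) (INR n) * Q alpha delta nu (Z.of_nat n + 1) y
  + b_0 alpha delta (INR nu) (INR n) * Q alpha delta nu (Z.of_nat n) y
  + b_m1 alpha delta (INR nu) (INR n) * Q alpha delta nu (Z.of_nat n - 1) y
  + b_m2 alpha delta (INR nu) (INR n) * Q alpha delta nu (Z.of_nat n - 2) y.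
Proof.
  intros Ha Hs Hy.
  assert (Ha' : alpha <> 0) by lra.
  set (s := alpha ^ 2 - delta ^ 2) in *.
  assert (Hr : s / alpha <> 0)
    by (apply Rmult_integral_contrapositive; split; [lra|now apply Rinv_neq_0_compat]).
  set (U := fun t => usum (s / alpha) nu (basisQ alpha nu y) t (S (S n))).
  set (c := normQ alpha delta nu n).
  pose proof (pos_INR n) as Hn.
  (* [normQ] changes by inverse squares, so here it is [b_2] and [b_1] that contain the weights
     cancelling the ratios. *)
  assert (H2 : (INR n + 2) ^ 2 * (INR n + 1) ^ 2 * Q alpha delta nu (Z.of_nat n + 2) y =
    c * U (INR n + 2)).
  { replace (Z.of_nat n + 2)%Z with (Z.of_nat (S (S n))) by lia.
    unfold c, U; rewrite (Q_of_nat _ _ _ _ 0), (normQ_S _ _ _ n), (normQ_S _ _ _ (S n)), !S_INR by assumption.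
    replace (INR n + 2) with (INR n + 1 + 1) by ring; fold s; simpl Nat.add; ring. }
  assert (H1 : (INR n + 1) ^ 2 * Q alpha delta nu (Z.of_nat n + 1) y = - c * U (INR n + 1)).
  { replace (Z.of_nat n + 1)%Z with (Z.of_nat (S n)) by lia.
    unfold c, U; rewrite (Q_of_nat _ _ _ _ 1), (normQ_S _ _ _ n), S_INR by assumption.
    fold s; simpl Nat.add; ring. }
  assert (H0 : Q alpha delta nu (Z.of_nat n) y = c * U (INR n))
    by (now apply (Q_of_nat _ _ _ _ 2)).
  (* At [n = 0] both sides are zero whatever the value of [/ 0], since the Q on the left has a
     negative index; likewise in [Hm2] at [n = 0] and [n = 1]. *)
  assert (Hm1 : / INR n * Q alpha delta nu (Z.of_nat n - 1) y = - INR n * c * U (INR n - 1)).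
  { destruct n as [|n]; [rewrite Q_neg by lia; simpl; ring|].
    replace (Z.of_nat (S n) - 1)%Z with (Z.of_nat n) by lia.
    unfold U, c; rewrite (Q_of_nat _ _ _ _ 3), (normQ_S _ _ _ n) by assumption.
    rewrite S_INR in *; replace (INR n + 1 - 1) with (INR n) by ring.
    fold s; simpl Nat.add; pose proof (pos_INR n); field; lra. }
  assert (Hm2 : / (INR n * (INR n - 1)) * Q alpha delta nu (Z.of_nat n - 2) y =
    INR n * (INR n - 1) * c * U (INR n - 2)).
  { destruct n as [|[|n]]; [rewrite Q_neg by lia; simpl; ring|rewrite Q_neg by lia; simpl; ring|].
    replace (Z.of_nat (S (S n)) - 2)%Z with (Z.of_nat n) by lia.
    unfold U, c; rewrite (Q_of_nat _ _ _ _ 4), (normQ_S _ _ _ n), (normQ_S _ _ _ (S n)) by assumption.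
    rewrite !S_INR in *; replace (INR n + 1 + 1 - 2) with (INR n) by ring.
    fold s; simpl Nat.add; pose proof (pos_INR n); field; lra. }
  assert (Key := usum_recurrence_Q (s / alpha) (/ s) nu n y (basisQ alpha nu y) Hr).
  cbv zeta in Key.
  rewrite <- (usum_truncate _ _ _ _ 2) in Key; change (2 + n)%nat with (S (S n)) in Key.
  fold (U (INR n + 2)) (U (INR n + 1)) (U (INR n)) (U (INR n - 1)) (U (INR n - 2)) in Key.
  replace (b_2 alpha delta (INR nu) (INR n) * Q alpha delta nu (Z.of_nat n + 2) y) with
    ((INR nu + INR n + 2) * (INR nu + INR n + 1) * (alpha ^ 2 / s ^ 2) *
     ((INR n + 2) ^ 2 * (INR n + 1) ^ 2 * Q alpha delta nu (Z.of_nat n + 2) y))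
    by (unfold b_2; fold s; ring).
  replace (b_1 alpha delta (INR nu) (INR n) * Q alpha delta nu (Z.of_nat n + 1) y) with
    ((- ((INR n + INR nu + 1) ^ 2 / s)
      + 2 * (2 * INR n + INR nu + 2) * (INR n + INR nu + 1) * (alpha ^ 2 / s ^ 2)) *
     ((INR n + 1) ^ 2 * Q alpha delta nu (Z.of_nat n + 1) y))
    by (unfold b_1; fold s; field; lra).
  replace (b_m1 alpha delta (INR nu) (INR n) * Q alpha delta nu (Z.of_nat n - 1) y) with
    ((- ((3 * INR n + 2 * INR nu) / s) + 2 * (2 * INR n + INR nu) * (alpha ^ 2 / s ^ 2)) *
     (/ INR n * Q alpha delta nu (Z.of_nat n - 1) y))
    by (unfold b_m1; fold s; unfold Rdiv; ring).
  (* Here [delta^2 = alpha^2 - s] turns [delta^2/s^2] into [1/r^2 - q], with [r = s/alpha]. *)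
  replace (b_m2 alpha delta (INR nu) (INR n) * Q alpha delta nu (Z.of_nat n - 2) y) with
    ((alpha ^ 2 - s) / s ^ 2 *
     (/ (INR n * (INR n - 1)) * Q alpha delta nu (Z.of_nat n - 2) y))
    by (unfold b_m2; fold s; replace (alpha ^ 2 - s) with (delta ^ 2) by (unfold s; ring);
        unfold Rdiv; ring).
  rewrite Hm2, Hm1, H2, H1, H0.
  replace (y * (c * U (INR n))) with (c * (y * U (INR n))) by ring.
  rewrite Key.
  - unfold b_0; fold s; field; lra.
  - intros k; rewrite basisQ_recurrence by assumption; field; lra.
Qed.

Theorem proposition3p5 (mu : R) (nu : nat) (hmu : 0 < mu < 1) :
  let alpha := (1 + mu) / (2 * mu) in
  let delta := (1 - mu) / (2 * mu) in
  (forall (n : nat) (x : R), 0 < x ->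
     x * P alpha delta nu (Z.of_nat n) x =
       a_2 alpha delta (INR nu) (INR n) * P alpha delta nu (Z.of_nat n + 2) x
     + a_1 alpha delta (INR nu) (INR n) * P alpha delta nu (Z.of_nat n + 1) x
     + a_0 alpha delta (INR nu) (INR n) * P alpha delta nu (Z.of_nat n) x
     + a_m1 alpha delta (INR nu) (INR n) * P alpha delta nu (Z.of_nat n - 1) x
     + a_m2 alpha delta (INR nu) (INR n) * P alpha delta nu (Z.of_nat n - 2) x)
  /\
  (forall (n : nat) (y : R), 0 < y ->
     y * Q alpha delta nu (Z.of_nat n) y =
       b_2 alpha delta (INR nu) (INR n) * Q alpha delta nu (Z.of_nat n + 2) y
     + b_1 alpha delta (INR nu) (INR n) * Q alpha delta nu (Z.of_nat n + 1) y
     + b_0 alpha delta (INR nu) (INR n) * Q alpha delta nu (Z.of_nat n) y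
     + b_m1 alpha delta (INR nu) (INR n) * Q alpha delta nu (Z.of_nat n - 1) y
     + b_m2 alpha delta (INR nu) (INR n) * Q alpha delta nu (Z.of_nat n - 2) y).
Proof.
  intros alpha delta.
  assert (Ha : 0 < alpha) by (apply Rdiv_lt_0_compat; lra).
  assert (Hd : 0 < delta) by (apply Rdiv_lt_0_compat; lra).
  assert (Hs : 0 < alpha ^ 2 - delta ^ 2).
  (* Indeed [alpha - delta = 1] and [alpha + delta = 1/mu]. *)
  { replace (alpha ^ 2 - delta ^ 2) with (/ mu) by (unfold alpha, delta; field; lra).
    apply Rinv_0_lt_compat; lra. }
  split; intros; [apply P_recurrence|apply Q_recurrence]; lra.
Qed.
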